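(* Let $\mathcal M$ and $\mathcal N$ be full subcategories of a category $\mathcal C$, with $\mathcal N$ reflective and $\mathcal M$ coreflective. Let $N:\mathcal C\to\mathcal N$ be a reflector, with unit $\theta:1_{\mathcal C}\to \mathrm{Inc}_{\mathcal N}\circ N$ of $N\dashv\mathrm{Inc}_{\mathcal N}$, and let $M:\mathcal C\to\mathcal M$ be a coreflector, with counit $\psi:\mathrm{Inc}_{\mathcal M}\circ M\to 1_{\mathcal C}$ of $\mathrm{Inc}_{\mathcal M}\dashv M$. Then the composite adjunction $N|_{\mathcal M}\dashv M|_{\mathcal N}$ is an adjoint equivalence if and only if both of the following hold: (F) for each object $x$ of $\mathcal M$, $(x,\theta_x)$ is a final object in $\mathcal M\downarrow Nx$; (I) for each object $y$ of $\mathcal N$, $(y,\psi_y)$ is an initial object in $My\downarrow\mathcal N$.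
   Context: $\mathrm{Inc}_{\mathcal D}:\mathcal D\to\mathcal C$ denotes the inclusion functor of a subcategory $\mathcal D$. A subcategory $\mathcal N$ is reflective if $\mathrm{Inc}_{\mathcal N}$ has a left adjoint (a reflector); $\mathcal M$ is coreflective if $\mathrm{Inc}_{\mathcal M}$ has a right adjoint (a coreflector). $N|_{\mathcal M}=N\circ\mathrm{Inc}_{\mathcal M}:\mathcal M\to\mathcal N$ and $M|_{\mathcal N}=M\circ\mathrm{Inc}_{\mathcal N}:\mathcal N\to\mathcal M$; composing the adjunctions gives $N|_{\mathcal M}\dashv M|_{\mathcal N}$. An adjunction is an adjoint equivalence if both its unit and its counit are natural isomorphisms. For an object $c$ of $\mathcal C$ and a subcategory $\mathcal D$, the comma category $c\downarrow\mathcal D$ has as objects pairs $(y,f)$ with $y\in\mathcal D$ and $f:c\to y$ in $\mathcal C$, morphisms $(y,f)\to(z,g)$ being $h:y\to z$ in $\mathcal D$ with $h\circ f=g$; $\mathcal D\downarrow c$ has as objects pairs $(y,f)$ with $y\in\mathcal D$ and $f:y\to c$ in $\mathcal C$, morphisms $(y,f)\to(z,g)$ being $h:y\to z$ in $\mathcal D$ with $g\circ h=f$. *)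

(* Defs.v *)
From Stdlib Require Import ProofIrrelevance.

Set Implicit Arguments.
Unset Strict Implicit.
Unset Printing Implicit Defensive.

Record Category : Type := {
  Ob :> Type;
  Hom : Ob -> Ob -> Type;
  idm : forall x : Ob, Hom x x;
  comp : forall x y z : Ob, Hom y z -> Hom x y -> Hom x z;
  comp_idl : forall (x y : Ob) (f : Hom x y), comp (idm y) f = f;
  comp_idr : forall (x y : Ob) (f : Hom x y), comp f (idm x) = f;
  comp_assoc : forall (x y z w : Ob) (h : Hom z w) (g : Hom y z) (f : Hom x y),
    comp h (comp g f) = comp (comp h g) f
}.

Arguments Hom {c} x y.
Arguments idm {c} x.
Arguments comp {c x y z} g f.

Declare Scope cat_scope.
Delimit Scope cat_scope with cat.
Open Scope cat_scope.

Notation "g ∘ f" := (comp g f) (at level 40, left associativity) : cat_scope.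

Definition is_iso (C : Category) (x y : C) (f : Hom x y) : Prop :=
  exists g : Hom y x, g ∘ f = idm x /\ f ∘ g = idm y.

Definition is_initial (C : Category) (x : C) : Prop :=
  forall y : C, exists! f : Hom x y, True.

Definition is_final (C : Category) (x : C) : Prop :=
  forall y : C, exists! f : Hom y x, True.

Record Functor (C D : Category) : Type := {
  fobj :> C -> D;
  fmap : forall x y : C, Hom x y -> Hom (fobj x) (fobj y);
  fmap_id : forall x : C, fmap (idm x) = idm (fobj x);
  fmap_comp : forall (x y z : C) (g : Hom y z) (f : Hom x y),
    fmap (g ∘ f) = fmap g ∘ fmap f
}.

Arguments fmap {C D} f {x y} h : rename.

Definition functor_id (C : Category) : Functor C C.
Proof.
  refine {| fobj := fun x : C => x; fmap := fun x y (f : Hom x y) => f |}.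
  - reflexivity.
  - reflexivity.
Defined.

Definition functor_comp (C D E : Category) (G : Functor D E) (F : Functor C D) :
  Functor C E.
Proof.
  refine {| fobj := fun x : C => G (F x);
            fmap := fun x y (f : Hom x y) => fmap G (fmap F f) |}.
  - intros x. rewrite !fmap_id. reflexivity.
  - intros x y z g f. rewrite !fmap_comp. reflexivity.
Defined.

Record NatTrans (C D : Category) (F G : Functor C D) : Type := {
  component :> forall x : C, Hom (F x) (G x);
  naturality : forall (x y : C) (f : Hom x y),
    component y ∘ fmap F f = fmap G f ∘ component x
}.

Definition is_nat_iso (C D : Category) (F G : Functor C D) (t : NatTrans F G) :
  Prop := forall x : C, is_iso (t x).

(* [Adjunction F G] is the structure of an adjunction with [F] left adjoint
   to [G]. *)
Record Adjunction (C D : Category) (F : Functor C D) (G : Functor D C) : Type := {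
  unit : NatTrans (functor_id C) (functor_comp G F);
  counit : NatTrans (functor_comp F G) (functor_id D);
  triangle_left : forall x : C,
    (counit (F x) : Hom (F (G (F x))) (F x)) ∘ fmap F (unit x) = idm (F x);
  triangle_right : forall y : D,
    fmap G (counit y) ∘ (unit (G y) : Hom (G y) (G (F (G y)))) = idm (G y)
}.

Arguments unit {C D F G} a : rename.
Arguments counit {C D F G} a : rename.

Definition is_adjoint_equivalence (C D : Category) (F : Functor C D)
  (G : Functor D C) (A : Adjunction F G) : Prop :=
  is_nat_iso (unit A) /\ is_nat_iso (counit A).

Section AdjunctionComposition.

Variables (C D E : Category).
Variables (F : Functor C D) (G : Functor D C).
Variables (F' : Functor D E) (G' : Functor E D).
Variables (A : Adjunction F G) (B : Adjunction F' G').

Definition adj_comp_unit :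
  NatTrans (functor_id C) (functor_comp (functor_comp G G') (functor_comp F' F)).
Proof.
  refine (@Build_NatTrans C C (functor_id C)
    (functor_comp (functor_comp G G') (functor_comp F' F))
    (fun x : C => fmap G (unit B (F x)) ∘ unit A x) _).
  intros x y f; simpl.
  pose proof (naturality (unit A) f) as HA; simpl in HA.
  pose proof (naturality (unit B) (fmap F f)) as HB; simpl in HB.
  rewrite <- comp_assoc, HA, comp_assoc, <- fmap_comp, HB, fmap_comp, comp_assoc.
  reflexivity.
Defined.

Definition adj_comp_counit :
  NatTrans (functor_comp (functor_comp F' F) (functor_comp G G')) (functor_id E).
Proof.
  refine (@Build_NatTrans E E
    (functor_comp (functor_comp F' F) (functor_comp G G')) (functor_id E)
    (fun y : E => counit B y ∘ fmap F' (counit A (G' y))) _).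
  intros x y f; simpl.
  pose proof (naturality (counit A) (fmap G' f)) as HA; simpl in HA.
  pose proof (naturality (counit B) f) as HB; simpl in HB.
  rewrite <- comp_assoc, <- fmap_comp, HA, fmap_comp, comp_assoc, HB, comp_assoc.
  reflexivity.
Defined.

Definition adj_comp : Adjunction (functor_comp F' F) (functor_comp G G').
Proof.
  refine {| unit := adj_comp_unit; counit := adj_comp_counit |}.
  - intros x; simpl.
    pose proof (naturality (counit A) (unit B (F x))) as HA; simpl in HA.
    pose proof (triangle_left B (F x)) as HL; simpl in HL.
    rewrite <- HL, <- (comp_assoc (counit B (F' (F x)))).
    f_equal.
    etransitivity; [symmetry; apply (fmap_comp F') |].
    f_equal.
    rewrite fmap_comp, comp_assoc, HA, <- comp_assoc.
    pose proof (triangle_left A x) as HL'; simpl in HL'.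
    rewrite HL'. apply comp_idr.
  - intros y; simpl.
    pose proof (naturality (unit B) (counit A (G' y))) as HB; simpl in HB.
    pose proof (triangle_right A (G' y)) as HR; simpl in HR.
    rewrite <- HR. etransitivity; [apply comp_assoc |].
    f_equal.
    etransitivity; [symmetry; apply (fmap_comp G) |].
    f_equal.
    rewrite fmap_comp, <- comp_assoc, <- HB, comp_assoc.
    pose proof (triangle_right B y) as HR'; simpl in HR'.
    rewrite HR'. apply comp_idl.
Defined.

End AdjunctionComposition.

(* A full subcategory of [C] is given by the class [P] of its objects. *)
Definition full_subcategory (C : Category) (P : C -> Prop) : Category.
Proof.
  refine {| Ob := {x : C | P x};
            Hom := fun x y => Hom (proj1_sig x) (proj1_sig y);
            idm := fun x => idm (proj1_sig x);
            comp := fun x y z g f => g ∘ f |}.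
  - intros x y f. apply comp_idl.
  - intros x y f. apply comp_idr.
  - intros x y z w h g f. apply comp_assoc.
Defined.

Definition Inc (C : Category) (P : C -> Prop) : Functor (full_subcategory P) C.
Proof.
  refine (@Build_Functor (full_subcategory P) C (fun x => proj1_sig x)
    (fun x y (f : Hom (proj1_sig x) (proj1_sig y)) => f) _ _).
  - reflexivity.
  - reflexivity.
Defined.

Arguments Inc {C} P.

Section CommaCategories.

Variables (C : Category) (P : C -> Prop) (c : C).

Record under_obj : Type := Under {
  under_cod : full_subcategory P;
  under_mor : Hom c (Inc P under_cod)
}.

Definition under_hom (a b : under_obj) : Type :=
  {h : Hom (under_cod a) (under_cod b) |
    fmap (Inc P) h ∘ under_mor a = under_mor b}.

Record over_obj : Type := Over {
  over_dom : full_subcategory P;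
  over_mor : Hom (Inc P over_dom) c
}.

Definition over_hom (a b : over_obj) : Type :=
  {h : Hom (over_dom a) (over_dom b) |
    over_mor b ∘ fmap (Inc P) h = over_mor a}.

Lemma under_hom_eq (a b : under_obj) (f g : under_hom a b) :
  proj1_sig f = proj1_sig g -> f = g.
Proof.
  destruct f as [f hf], g as [g hg]; simpl; intros e; subst g.
  f_equal; apply proof_irrelevance.
Qed.

Lemma over_hom_eq (a b : over_obj) (f g : over_hom a b) :
  proj1_sig f = proj1_sig g -> f = g.
Proof.
  destruct f as [f hf], g as [g hg]; simpl; intros e; subst g.
  f_equal; apply proof_irrelevance.
Qed.

Definition under_id (a : under_obj) : under_hom a a.
Proof. exists (idm (under_cod a)). apply comp_idl. Defined.

Definition under_comp (a b d : under_obj) (g : under_hom b d)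
  (f : under_hom a b) : under_hom a d.
Proof.
  exists (proj1_sig g ∘ proj1_sig f).
  destruct g as [g hg], f as [f hf]; simpl in *.
  rewrite <- comp_assoc, hf. exact hg.
Defined.

Definition over_id (a : over_obj) : over_hom a a.
Proof. exists (idm (over_dom a)). apply comp_idr. Defined.

Definition over_comp (a b d : over_obj) (g : over_hom b d)
  (f : over_hom a b) : over_hom a d.
Proof.
  exists (proj1_sig g ∘ proj1_sig f).
  destruct g as [g hg], f as [f hf]; simpl in *.
  rewrite comp_assoc, hg. exact hf.
Defined.

(* The comma category c \downarrow P, whose objects are the morphisms from [c] to an
   object of the full subcategory. *)
Definition comma_under : Category.
Proof.
  refine {| Ob := under_obj; Hom := under_hom;
            idm := under_id; comp := under_comp |}.
  - intros x y f. apply under_hom_eq. apply (comp_idl (proj1_sig f)).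
  - intros x y f. apply under_hom_eq. apply (comp_idr (proj1_sig f)).
  - intros x y z w h g f. apply under_hom_eq.
    apply (comp_assoc (proj1_sig h) (proj1_sig g) (proj1_sig f)).
Defined.

(* The comma category P \downarrow c, whose objects are the morphisms from an object of
   the full subcategory to [c]. *)
Definition comma_over : Category.
Proof.
  refine {| Ob := over_obj; Hom := over_hom;
            idm := over_id; comp := over_comp |}.
  - intros x y f. apply over_hom_eq. apply (comp_idl (proj1_sig f)).
  - intros x y f. apply over_hom_eq. apply (comp_idr (proj1_sig f)).
  - intros x y z w h g f. apply over_hom_eq.
    apply (comp_assoc (proj1_sig h) (proj1_sig g) (proj1_sig f)).
Defined.

End CommaCategories.

Arguments comma_under {C} P c.
Arguments comma_over {C} P c.
Arguments Under {C P c} under_cod under_mor.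
Arguments Over {C P c} over_dom over_mor.

(* Main.v *)
(* Coreflectivity makes (Mc, psi_c) final in the comma category M ↓ c, so an
   object of M ↓ c is final exactly when its morphism to (Mc, psi_c) is an
   isomorphism.  The unit of N|_M -| M|_N at x is the morphism from (x, theta_x)
   to (M N x, psi_(N x)); hence (F) says that this unit is invertible.  Dually,
   (I) says that the counit is invertible. *)

Require Import Defs.

Set Implicit Arguments.
Unset Strict Implicit.

(** If [x] is final too, it supplies a morphism [t] to [x]; both composites with [u] are
    endomorphisms of final objects, hence identities. Conversely, an inverse of [u] transports
    finality from [t] to [x]. *)
Lemma final_iff_iso (C : Category) (x t : C) (u : Hom x t) :
  is_final t -> (is_final x <-> is_iso u).
Proof.
  intros Ht; split.
  - intros Hx. destruct (Hx t) as [v _]. exists v; split.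
    + destruct (Hx x) as [w [_ Hw]].
      transitivity w; [symmetry |]; apply Hw; exact I.
    + destruct (Ht t) as [w [_ Hw]].
      transitivity w; [symmetry |]; apply Hw; exact I.
  - intros [v [Hvu _]] y. destruct (Ht y) as [w [_ Hw]].
    exists (v ∘ w); split; [exact I |].
    (* Finality of [t] forces [w = u ∘ f], and cancelling [u] gives [v ∘ w = f]. *)
    intros f _. rewrite (Hw (u ∘ f) I), comp_assoc, Hvu. apply comp_idl.
Qed.

Lemma initial_iff_iso (C : Category) (x t : C) (u : Hom t x) :
  is_initial t -> (is_initial x <-> is_iso u).
Proof.
  intros Ht; split.
  - intros Hx. destruct (Hx t) as [v _]. exists v; split.
    + destruct (Ht t) as [w [_ Hw]].
      transitivity w; [symmetry |]; apply Hw; exact I.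
    + destruct (Hx x) as [w [_ Hw]].
      transitivity w; [symmetry |]; apply Hw; exact I.
  - intros [v [_ Huv]] y. destruct (Ht y) as [w [_ Hw]].
    exists (w ∘ v); split; [exact I |].
    intros f _. rewrite (Hw (f ∘ u) I), <- comp_assoc, Huv.
    apply comp_idr.
Qed.

(** An inverse of the underlying morphism automatically commutes with the morphisms to [c], so it
    lifts to the comma category. *)
Lemma over_iso_iff (C : Category) (P : C -> Prop) (c : C)
  (a b : comma_over P c) (u : Hom a b) :
  is_iso u <-> is_iso (proj1_sig u).
Proof.
  split.
  - intros [v [Hvu Huv]]. exists (proj1_sig v); split.
    + exact (f_equal (@proj1_sig _ _) Hvu).
    + exact (f_equal (@proj1_sig _ _) Huv).
  - destruct u as [u Hu]. intros [v [Hvu Huv]]; simpl in *.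
    assert (Hv : over_mor a ∘ v = over_mor b).
    { rewrite <- Hu, <- comp_assoc, Huv. apply comp_idr. }
    exists (exist _ v Hv : @Hom (comma_over P c) b a).
    split; apply over_hom_eq; assumption.
Qed.

Lemma under_iso_iff (C : Category) (P : C -> Prop) (c : C)
  (a b : comma_under P c) (u : Hom a b) :
  is_iso u <-> is_iso (proj1_sig u).
Proof.
  split.
  - intros [v [Hvu Huv]]. exists (proj1_sig v); split.
    + exact (f_equal (@proj1_sig _ _) Hvu).
    + exact (f_equal (@proj1_sig _ _) Huv).
  - destruct u as [u Hu]. intros [v [Hvu Huv]]; simpl in *.
    assert (Hv : v ∘ under_mor b = under_mor a).
    { rewrite <- Hu, comp_assoc, Hvu. apply comp_idl. }
    exists (exist _ v Hv : @Hom (comma_under P c) b a).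
    split; apply under_hom_eq; assumption.
Qed.

Section Transposition.

Variables (C D : Category) (F : Functor C D) (G : Functor D C).
Variable A : Adjunction F G.

(** Naturality of the counit moves [g] to the left, leaving a triangle identity. With the next
    lemma, this makes transposition a bijection of hom-sets. *)
Lemma counit_comp_transpose (x : C) (d : D) (g : Hom (F x) d) :
  counit A d ∘ fmap F (fmap G g ∘ unit A x) = g.
Proof.
  pose proof (naturality (counit A) g) as Hn; simpl in Hn.
  pose proof (triangle_left A x) as Ht; simpl in Ht.
  simpl; rewrite (fmap_comp F), comp_assoc, Hn, <- comp_assoc, Ht.
  apply comp_idr.
Qed.

Lemma transpose_counit_comp (x : C) (d : D) (h : Hom x (G d)) :
  fmap G (counit A d ∘ fmap F h) ∘ unit A x = h.
Proof.
  pose proof (naturality (unit A) h) as Hn; simpl in Hn.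
  pose proof (triangle_right A d) as Ht; simpl in Ht.
  simpl; rewrite (fmap_comp G), <- comp_assoc, <- Hn, comp_assoc, Ht.
  apply comp_idl.
Qed.

End Transposition.

(** A morphism from [(y, g)] is an [h] with [counit A c ∘ h = g]. The two transposition identities
    say that the transpose of [g] is such an [h], and the only one. *)
Lemma counit_final (C : Category) (P : C -> Prop)
  (M : Functor C (full_subcategory P)) (A : Adjunction (Inc P) M) (c : C) :
  @is_final (comma_over P c) (Over (M c) (counit A c)).
Proof.
  intros [y g].
  exists (exist _ (fmap M g ∘ unit A y) (counit_comp_transpose A g)
    : @Hom (comma_over P c) (Over y g) (Over (M c) (counit A c))).
  split; [exact I |].
  intros [h Hh] _. apply over_hom_eq; simpl in *.
  rewrite <- Hh. apply (transpose_counit_comp A h).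
Qed.

Lemma unit_initial (C : Category) (P : C -> Prop)
  (N : Functor C (full_subcategory P)) (A : Adjunction N (Inc P)) (c : C) :
  @is_initial (comma_under P c) (Under (N c) (unit A c)).
Proof.
  intros [y g].
  exists (exist _ (counit A y ∘ fmap N g) (transpose_counit_comp A g)
    : @Hom (comma_under P c) (Under (N c) (unit A c)) (Under y g)).
  split; [exact I |].
  intros [h Hh] _. apply under_hom_eq; simpl in *.
  rewrite <- Hh. apply (counit_comp_transpose A h).
Qed.

(** The transpose of [f] underlies the morphism [u] from [(x, f)] to the final object given by the
    counit. *)
Lemma over_final_iff_transpose_iso (C : Category) (P : C -> Prop)
  (M : Functor C (full_subcategory P)) (A : Adjunction (Inc P) M)
  (c : C) (x : full_subcategory P) (f : Hom (Inc P x) c) :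
  @is_final (comma_over P c) (Over x f) <-> is_iso (fmap M f ∘ unit A x).
Proof.
  pose (u := exist _ (fmap M f ∘ unit A x) (counit_comp_transpose A f)
    : @Hom (comma_over P c) (Over x f) (Over (M c) (counit A c))).
  apply (iff_trans (final_iff_iso u (counit_final A (c := c)))).
  apply (over_iso_iff u).
Qed.

Lemma under_initial_iff_transpose_iso (C : Category) (P : C -> Prop)
  (N : Functor C (full_subcategory P)) (A : Adjunction N (Inc P))
  (c : C) (y : full_subcategory P) (f : Hom c (Inc P y)) :
  @is_initial (comma_under P c) (Under y f) <-> is_iso (counit A y ∘ fmap N f).
Proof.
  pose (u := exist _ (counit A y ∘ fmap N f) (transpose_counit_comp A f)
    : @Hom (comma_under P c) (Under (N c) (unit A c)) (Under y f)).
  apply (iff_trans (initial_iff_iso u (unit_initial A (c := c)))).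
  apply (under_iso_iff u).
Qed.

Theorem corollary4p4 (C : Category) (PM PN : C -> Prop)
  (N : Functor C (full_subcategory PN)) (adjN : Adjunction N (Inc PN))
  (M : Functor C (full_subcategory PM)) (adjM : Adjunction (Inc PM) M) :
  let theta : NatTrans (functor_id C) (functor_comp (Inc PN) N) := unit adjN in
  let psi : NatTrans (functor_comp (Inc PM) M) (functor_id C) := counit adjM in
  let adj : Adjunction (functor_comp N (Inc PM)) (functor_comp M (Inc PN)) :=
    adj_comp adjM adjN in
  is_adjoint_equivalence adj <->
  (forall x : full_subcategory PM,
     @is_final (comma_over PM (Inc PN (N (Inc PM x))))
       (Over x (theta (Inc PM x)))) /\
  (forall y : full_subcategory PN,
     @is_initial (comma_under PN (Inc PM (M (Inc PN y))))
       (Under y (psi (Inc PN y)))).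
Proof.
  intros theta psi adj; split.
  - intros [Hu Hc]; split.
    (* By definition of [adj_comp], the composite unit at [x] is the transpose of [theta] at [x]
       under [adjM]. *)
    + intros x. apply (over_final_iff_transpose_iso adjM). apply (Hu x).
    (* Likewise the composite counit at [y] is the transpose of [psi] at [y] under [adjN]. *)
    + intros y. apply (under_initial_iff_transpose_iso adjN). apply (Hc y).
  - intros [HF HI]; split.
    + intros x. apply (over_final_iff_transpose_iso adjM (theta (Inc PM x))).
      apply HF.
    + intros y. apply (under_initial_iff_transpose_iso adjN (psi (Inc PN y))).
      apply HI.
Qed.
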